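(* Let $G$ be a finite graph with matching number $\nu$. Suppose every edge of $G$ is adjacent to exactly $d$ other edges, and every pair of independent edges is connected by exactly $\lambda$ edges of $G$. Then the number $N$ of shellings of $G$ satisfies $$\frac N{|E(G)|!}=\frac\nu{\binom{\frac{d+1}{\lambda/2}}{\nu-1}}.$$
   Context: A shelling of $G$ is a linear ordering of its edges such that for every $i$ the first $i$ edges induce a connected subgraph. Two distinct edges are adjacent if they share a vertex, independent otherwise; an edge connects two independent edges if it shares a vertex with each. The matching number is the maximum size of a set of pairwise independent edges. For non-integer $a$, $\binom{a}{b}$ is the polynomial $a(a-1)\cdots(a-b+1)/b!$ of degree $b$ in $a$. *)

(* Defs.v *)
From mathcomp Require Import all_boot all_order all_algebra.
Set Implicit Arguments.
Unset Strict Implicit.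
Unset Printing Implicit Defensive.
Import Order.TTheory GRing.Theory Num.Theory.

(* A finite simple graph is a symmetric irreflexive relation [g] on a finite
   type; its edges are the two-element vertex sets [set x; y] with [g x y]. *)
Section Graph.
Variables (V : finType) (g : rel V).

Definition edges : {set {set V}} :=
  [set [set p.1; p.2] | p : V * V & g p.1 p.2].

Definition share_vertex (A B : {set V}) : bool := A :&: B != set0.

Definition edge_adj (A B : {set V}) : bool := (A != B) && share_vertex A B.

Definition edge_indep (A B : {set V}) : bool := (A != B) && ~~ share_vertex A B.

Definition edge_connects (C A B : {set V}) : bool :=
  share_vertex C A && share_vertex C B.

Definition is_matching (M : {set {set V}}) : bool :=
  (M \subset edges) &&
  [forall A in M, forall B in M, (A != B) ==> edge_indep A B].

Definition matching_number : nat :=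
  \max_(M : {set {set V}} | is_matching M) #|M|.

(* The subgraph induced by a set [F] of edges has vertex set [cover F] and edge
   set [F]; for x = y, [set x; y] is a singleton and hence never an edge. *)
Definition induces_connected (F : {set {set V}}) : bool :=
  [forall x in cover F, forall y in cover F,
     connect (fun u v => [set u; v] \in F) x y].

Definition is_shelling (s : #|edges|.-tuple {set V}) : bool :=
  [&& uniq s, [set A in s] == edges &
   [forall i : 'I_#|edges|, induces_connected [set A in take i.+1 s]]].

Definition num_shellings : nat := #|[set s | is_shelling s]|.

End Graph.

Local Open Scope ring_scope.

Definition gbinom (a : rat) (b : nat) : rat :=
  (\prod_(i < b) (a - i%:R)) / (b`!)%:R.

(* Main.v *)
Require Import Defs.
From mathcomp Require Import all_boot all_order all_algebra.
From mathcomp Require Import ring lra.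
Set Implicit Arguments.
Unset Strict Implicit.
Unset Printing Implicit Defensive.
Import Order.TTheory GRing.Theory Num.Theory.
Local Open Scope ring_scope.

(** Call an edge a local minimum of an ordering of E(G) if it precedes all the
    edges adjacent to it.  Local minima form a matching, and an ordering is a
    shelling iff it has exactly one of them, so inclusion-exclusion gives
    [N = - \sum_M (-1)^|M| |M| c(M)], where M runs over the matchings and c(M)
    counts the orderings in which every edge of M is a local minimum.  An edge
    meets at most two members of M, so a k-matching dominates exactly
    [k (D - (k - 1) l)] edges, where [D = d + 1] and [l = lambda / 2].  Looking at the
    first edge of an ordering yields [c(M) = |E|! / \prod_(j < k) (D - j l)];
    extending matchings edge by edge yields the number
    ['C(nu, k) \prod_(j < k) (D - (nu - 1 + j) l)] of k-matchings.  The
    resulting alternating sum is evaluated by the Chu-Vandermonde identity. *)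

(** * Summation identities and the first-entry recursion for orderings *)

(* The Chu-Vandermonde identity, homogenized by [l] so that [l = 0] is allowed. *)
Lemma chu_vandermonde (F : fieldType) (l : F) (n : nat) (b c : F) :
  (forall j, (j < n)%N -> c - j%:R * l != 0) ->
  \sum_(k < n.+1) (-1) ^+ k * 'C(n, k)%:R *
      (\prod_(j < k) (b - j%:R * l) / \prod_(j < k) (c - j%:R * l)) =
  \prod_(j < n) (c - b - j%:R * l) / \prod_(j < n) (c - j%:R * l).
Proof.
elim: n b c => [|n IHn] b c c_neq0.
  by rewrite big_ord1 !big_ord0 bin0 expr0 !mul1r.
pose u k := \prod_(j < k) (b - j%:R * l) / \prod_(j < k) (c - j%:R * l).
pose u' k := \prod_(j < k) (b - l - j%:R * l) / \prod_(j < k) (c - l - j%:R * l).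
have prod_shift x k : \prod_(j < k.+1) (x - j%:R * l) =
    x * \prod_(j < k) (x - l - j%:R * l).
  rewrite big_ord_recl mul0r subr0; congr (_ * _); apply: eq_bigr => j _.
  by rewrite lift0 -natr1; ring.
have u_shift k : u k.+1 = b / c * u' k.
  by rewrite /u /u' !prod_shift invfM; ring.
(* Pascal's rule splits the sum in two; by [u_shift] the second part is the sum of order [n] for
   [b - l] and [c - l], which has the same difference [c - b]. *)
have -> : \sum_(k < n.+2) (-1) ^+ k * 'C(n.+1, k)%:R * u k =
    \sum_(k < n.+1) (-1) ^+ k * 'C(n, k)%:R * u k -
    b / c * \sum_(k < n.+1) (-1) ^+ k * 'C(n, k)%:R * u' k.
  have -> : \sum_(k < n.+1) (-1) ^+ k * 'C(n, k)%:R * u k =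
      \sum_(k < n.+2) (-1) ^+ k * 'C(n, k)%:R * u k.
    by rewrite [RHS]big_ord_recr /= bin_small // mulr0 mul0r addr0.
  rewrite big_ord_recl [in RHS]big_ord_recl !bin0 -addrA; congr (_ + _).
  rewrite mulr_sumr -sumrB; apply: eq_bigr => k _.
  by rewrite !lift0 binS natrD u_shift exprS; ring.
rewrite IHn; last by move=> j jn; apply: c_neq0; apply: ltnW.
rewrite IHn; last first.
  by move=> j jn; move: (c_neq0 j.+1 jn); rewrite -natr1 mulrDl mul1r opprD addrA addrAC.
have -> : c - l - (b - l) = c - b by ring.
have cE : \prod_(j < n) (c - j%:R * l) * (c - n%:R * l) =
    c * \prod_(j < n) (c - l - j%:R * l).
  by rewrite -(prod_shift c) [RHS]big_ord_recr.
have cn0 : \prod_(j < n) (c - j%:R * l) != 0.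
  by apply/prodf_neq0 => j _; apply: c_neq0; apply: ltnW (ltn_ord j).
have z0 := c_neq0 n (ltnSn n).
rewrite !big_ord_recr /=.
rewrite [X in _ - X]mulrACA -invfM -cE.
by field; rewrite cn0 z0.
Qed.

(** By absorption, [k * 'C(n, k) = n * 'C(n - 1, k - 1)], so the sum is [- n (1 - 1)^(n - 1)], which
    survives only at [n = 1], where [0 ^+ 0 = 1]. *)
Lemma alternating_sum_mul_bin (R : comPzRingType) (n : nat) :
  \sum_(k < n.+1) (-1) ^+ k * (k * 'C(n, k))%:R = - (n == 1)%:R :> R.
Proof.
case: n => [|n]; first by rewrite big_ord1 mul0n mulr0 oppr0.
rewrite big_ord_recl mul0n mulr0 add0r.
transitivity (- n.+1%:R * (1 + -1) ^+ n : R).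
  rewrite exprDn mulr_sumr; apply: eq_bigr => k _.
  by rewrite !lift0 -mul_bin_diag natrM exprS expr1n -mulr_natr; ring.
by rewrite subrr; case: n => [|n]; [rewrite expr0 mulr1 | rewrite exprS mul0r mulr0 oppr0].
Qed.

Lemma sum_subsets_card (R : pzSemiRingType) (T : finType) (L : {set T}) (f : nat -> R) :
  \sum_(M : {set T} | M \subset L) f #|M| = \sum_(k < #|L|.+1) 'C(#|L|, k)%:R * f k.
Proof.
rewrite (partition_big (fun M : {set T} => inord #|M| : 'I_#|L|.+1) predT) //=.
apply: eq_bigr => k _.
rewrite (eq_bigl [in [set M : {set T} | (M \subset L) & (#|M| == k)]]); last first.
  move=> M; rewrite inE; case: (boolP (M \subset L)) => //= ML.
  by rewrite -val_eqE /= inordK // ltnS subset_leq_card.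
rewrite (eq_bigr (fun=> f k)); last by move=> M; rewrite inE => /andP[_ /eqP ->].
by rewrite sumr_const cards_draws mulr_natl.
Qed.

Lemma count_permutations_enum (T : finType) (S : {set T}) (P : pred (seq T)) :
  S != set0 ->
  count P (permutations (enum S)) =
  (\sum_(x in S) count (fun s => P (x :: s)) (permutations (enum (S :\ x))))%N.
Proof.
move=> S0.
have sz : (0 < size (enum S))%N by rewrite -cardE card_gt0.
rewrite (permP (permutationsE sz)) undup_id ?enum_uniq //.
rewrite count_flatten sumnE !big_map big_enum /=.
apply: eq_bigr => x xS.
rewrite count_map; apply/permP/perm_permutations/uniq_perm.
- by rewrite rem_uniq ?enum_uniq.
- by rewrite enum_uniq.
by move=> y; rewrite mem_rem_uniq ?enum_uniq // !inE !mem_enum !inE.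
Qed.

(** * Local minima of an ordering with respect to a conflict relation *)

Section LocalMinima.
Variables (T : finType) (E : {set T}) (r : rel T).
Hypotheses (r_refl : reflexive r) (r_sym : symmetric r).

(** Matchings, once [r] means equal or adjacent; this is why conflict forces equality here. *)
Definition independent (M : {set T}) : bool :=
  (M \subset E) && [forall x in M, forall y in M, r x y ==> (x == y)].

(** A closed neighbourhood: reflexivity of [r] puts an independent [M] inside it. *)
Definition dominated (M : {set T}) : {set T} :=
  [set y in E | [exists x in M, r x y]].

Definition local_minima (s : seq T) : {set T} :=
  [set x in s | ~~ has (r x) (take (index x s) s)].

Lemma independentP (M : {set T}) :
  reflect (M \subset E /\ {in M &, forall x y, r x y -> x = y}) (independent M).
Proof.
apply: (iffP andP) => -[ME Mr]; split=> //.
  by move=> x y xM yM rxy; move/forall_inP/(_ x xM)/forall_inP/(_ y yM): Mr;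
     rewrite rxy => /eqP.
apply/forall_inP => x xM; apply/forall_inP => y yM; apply/implyP => rxy.
by apply/eqP/Mr.
Qed.

Lemma dominatedP (M : {set T}) y :
  reflect (y \in E /\ exists2 x, x \in M & r x y) (y \in dominated M).
Proof. by rewrite inE; apply: (iffP andP) => -[? /exists_inP ?]; split. Qed.

Lemma independentS (M' M : {set T}) :
  M' \subset M -> independent M -> independent M'.
Proof.
move=> M'M /independentP[ME Mr]; apply/independentP; split.
  exact: subset_trans ME.
by move=> x y xM yM; apply: Mr; apply: (subsetP M'M).
Qed.

(** The one-element extensions of an independent set are thus counted by the size of its dominated
    set. *)
Lemma independentU1 (M : {set T}) x :
  independent (x |: M) && (x \notin M) =
  independent M && (x \in E :\: dominated M).
Proof.
apply/andP/andP => -[].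
  move=> iM xM; split; first exact: independentS (subsetU1 _ _) iM.
  have /independentP[ME Mr] := iM.
  rewrite inE (subsetP ME) ?setU11 // andbT; apply/negP => /dominatedP[_ [y yM ryx]].
  by move: xM; rewrite -(Mr y x) ?yM ?setU11 // inE yM orbT.
move=> iM; rewrite !inE negb_and andb_orl andNb /= => /andP[/exists_inP nx xE].
have /independentP[ME Mr] := iM.
split; last by apply/negP => xM; apply: nx; exists x.
apply/independentP; split; first by rewrite subUset sub1set xE.
move=> y z; rewrite !inE => /predU1P[->|yM] /predU1P[->|zM] // ryz.
- by case: nx; exists z; rewrite 1?r_sym.
- by case: nx; exists y.
- exact: Mr.
Qed.

(** A new first entry destroys the minima that conflict with it. This form serves recursion on the
    first entry; the [rcons] form serves the growth of a shelling. *)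
Lemma local_minima_cons x s :
  x \notin s ->
  local_minima (x :: s) = x |: [set y in local_minima s | ~~ r y x].
Proof.
move=> xs; apply/setP => y; rewrite !inE /=.
case: (eqVneq y x) => [->|yx] //=.
by rewrite negb_or -andbA [~~ r y x && _]andbC.
Qed.

Lemma local_minima_rcons s x :
  x \notin s ->
  local_minima (rcons s x) =
  if has (r x) s then local_minima s else x |: local_minima s.
Proof.
move=> xs; apply/setP => y.
rewrite [in LHS]inE mem_rcons in_cons -cats1 index_cat.
case: (eqVneq y x) => [->|yx] /=.
  rewrite (negPf xs) /= eqxx addn0 take_size_cat //.
  by case: ifP; rewrite !inE ?eqxx //= (negPf xs).
case: (boolP (y \in s)) => ys /=.
  rewrite takel_cat ?index_size //.
  by case: ifP; rewrite !inE ys ?(negPf yx).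
by case: ifP; rewrite !inE (negPf ys) ?(negPf yx).
Qed.

Lemma local_minima_independent s :
  uniq s -> {subset s <= E} -> independent (local_minima s).
Proof.
elim: s => [|x s IHs] /=.
  move=> _ _; apply/independentP; split; first by apply/subsetP => x; rewrite inE.
  by move=> x y; rewrite inE.
move=> /andP[xs us] sE; rewrite local_minima_cons //.
have /independentP[ME Mr] : independent (local_minima s).
  by apply: IHs => // y ys; apply: sE; rewrite in_cons ys orbT.
apply/independentP; split.
  rewrite subUset sub1set sE ?mem_head //=.
  by apply: subset_trans ME; apply/subsetP => y; rewrite inE => /andP[].
have inP y : y \in x |: [set y in local_minima s | ~~ r y x] ->
    y = x \/ y \in local_minima s /\ ~~ r y x.
  by rewrite in_setU1 => /predU1P[->|]; [left | rewrite inE => /andP; right].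
move=> y z /inP[->|[yM ryx]] /inP[->|[zM rzx]] //.
- by rewrite r_sym (negPf rzx).
- by rewrite (negPf ryx).
- exact: Mr.
Qed.

Lemma sum_over_permutations (f : {set T} -> rat) :
  \sum_(s <- permutations (enum E)) \sum_(M : {set T} | M \subset local_minima s) f M =
  \sum_(M : {set T} | independent M)
    (count (fun s => M \subset local_minima s) (permutations (enum E)))%:R * f M.
Proof.
rewrite (exchange_big_dep predT) //=.
(* A dependent [M] lies in no [local_minima s], since these are independent. *)
rewrite (bigID independent) /= [X in _ + X]big1 ?addr0; last first.
  move=> M nM; rewrite big_seq_cond big1 // => s /andP[].
  rewrite mem_permutations => sE ML; case/negP: nM.
  apply: independentS ML _; apply: local_minima_independent.
    by rewrite (perm_uniq sE) enum_uniq.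
  by move=> x; rewrite (perm_mem sE) mem_enum.
by apply: eq_bigr => M _; rewrite big_const_seq iter_addr_0 mulr_natl.
Qed.

(** Summing [(-1)^|M| |M|] over the subsets [M] of a set [L] gives [-1] if [|L| = 1] and [0]
    otherwise; apply this to the local minima of each ordering. *)
Lemma count_one_local_minimum :
  (count (fun s => #|local_minima s| == 1)%N (permutations (enum E)))%:R =
  - \sum_(M : {set T} | independent M)
    (count (fun s => M \subset local_minima s) (permutations (enum E)))%:R *
    ((-1) ^+ #|M| * #|M|%:R) :> rat.
Proof.
rewrite -sum_over_permutations -sumrN -sum1_count natr_sum big_mkcond /=.
apply: eq_bigr => s _.
rewrite (sum_subsets_card _ (fun k => (-1) ^+ k * k%:R)).
under eq_bigr do rewrite mulrCA -natrM mulnC.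
by rewrite alternating_sum_mul_bin opprK; case: eqP.
Qed.

(** * Size of the dominated set under the regularity hypotheses *)

Variables (D lam : nat).
Hypothesis degE : forall x, x \in E -> #|[set y in E | r x y]| = D.
Hypothesis connE : forall x y, x \in E -> y \in E -> ~~ r x y ->
  #|[set z in E | r x z && r y z]| = lam.
Hypothesis dom_le2 : forall M y, independent M -> y \in E ->
  (#|[set x in M | r x y]| <= 2)%N.

Let l : rat := lam%:R / 2%:R.

(* If [t] members of [M] dominate [y] then [t <= 2], whence
   [2 * (0 < t) = 3 * t - t ^ 2]; sum over [y]. *)
Lemma card_dominated M : independent M ->
  #|dominated M|%:R = #|M|%:R * (D%:R - (#|M|%:R - 1) * l) :> rat.
Proof.
move=> iM; have /independentP[ME Mr] := iM.
pose t y := (\sum_(x in M) r x y)%N.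
have tE y : t y = #|[set x in M | r x y]|.
  by rewrite -sum1dep_card big_mkcondr /=; apply: eq_bigr => x _; case: (r x y).
have St : (\sum_(y in E) t y = #|M| * D)%N.
  rewrite exchange_big /= -sum_nat_const; apply: eq_bigr => x xM.
  rewrite -(degE (subsetP ME x xM)) -sum1dep_card big_mkcondr /=.
  by apply: eq_bigr => y _; case: (r x y).
(* Count triples [(x, z, y)] with [x], [z] in [M] both conflicting with [y]: each diagonal pair
   [x = z] gives [D], each other pair [lam]. *)
have Stt : (\sum_(y in E) t y * t y = #|M| * (D + #|M|.-1 * lam))%N.
  under eq_bigr do rewrite big_distrlr /=.
  rewrite exchange_big /= -sum_nat_const; apply: eq_bigr => x xM.
  rewrite exchange_big /= (big_setD1 x) //=; congr (_ + _)%N.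
    rewrite -(degE (subsetP ME x xM)) -sum1dep_card big_mkcondr /=.
    by apply: eq_bigr => y _; case: (r x y).
  have -> : #|M|.-1 = #|M :\ x| by rewrite (cardsD1 x M) xM.
  rewrite -sum_nat_const; apply: eq_bigr => z; rewrite !inE => /andP[zx zM].
  have nr : ~~ r x z.
    by apply/negP => /(Mr x z xM zM) xz; rewrite xz eqxx in zx.
  rewrite -(connE (subsetP ME x xM) (subsetP ME z zM) nr).
  rewrite -sum1dep_card big_mkcondr /=.
  by apply: eq_bigr => y _; case: (r x y); case: (r z y).
have key : (2 * #|dominated M| + \sum_(y in E) t y * t y = 3 * \sum_(y in E) t y)%N.
  rewrite -sum1dep_card big_mkcondr /= !big_distrr /= -big_split /=.
  apply: eq_bigr => y yE.
  have := dom_le2 iM yE; rewrite -tE.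
  have -> : [exists x in M, r x y] = (0 < t y)%N.
    rewrite tE card_gt0; apply/exists_inP/set0Pn => -[x].
      by move=> xM rxy; exists x; rewrite inE xM.
    by rewrite inE => /andP[]; exists x.
  by case: (t y) => [|[|[|]]].
move: key; rewrite St Stt => /(congr1 (fun n : nat => n%:R : rat)).
rewrite !natrD !natrM natrD natrM /l.
(* The truncated [#|M|.-1] equals [#|M| - 1] only for nonempty [M]. *)
case: (posnP #|M|) => [->|M0].
  by rewrite ?mul0n ?mul0r => h; lra.
have -> : #|M|.-1%:R = #|M|%:R - 1 :> rat by rewrite -subn1 natrB.
set m := #|M|%:R; set N := #|dominated M|%:R => h.
by lra.
Qed.


Lemma dominatedS (M' M : {set T}) :
  M' \subset M -> dominated M' \subset dominated M.
Proof.
move=> /subsetP M'M; apply/subsetP => y /dominatedP[yE [x xM rxy]].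
by apply/dominatedP; split=> //; exists x => //; apply: M'M.
Qed.

Lemma sub_dominated M : independent M -> M \subset dominated M.
Proof.
move=> /independentP[/subsetP ME _]; apply/subsetP => x xM.
by apply/dominatedP; split; [exact: ME | exists x].
Qed.

(** * Consequences of a maximum independent set *)

Variable nu : nat.
Hypothesis nu_max : forall M, independent M -> (#|M| <= nu)%N.
Hypothesis nu_ex : exists2 M, independent M & #|M| = nu.

(** A maximum independent set dominates all of [E], as an undominated element would extend it. *)
Lemma card_setE : #|E|%:R = nu%:R * (D%:R - (nu%:R - 1) * l) :> rat.
Proof.
have [M iM Mnu] := nu_ex.
rewrite -Mnu -card_dominated //; congr (_%:R); congr #|pred_of_set _|.
apply/eqP; rewrite eqEsubset andbC; apply/andP; split.
  by apply/subsetP => x /dominatedP[].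
apply/negPn/negP => /subsetPn[x xE xM].
have /andP[ixM xnM] : independent (x |: M) && (x \notin M).
  by rewrite independentU1 iM inE xE xM.
by have := nu_max ixM; rewrite cardsU1 xnM Mnu add1n ltnn.
Qed.

(** For [j = nu - 1] the value times [nu] is the size of a nonempty dominated set; smaller [j] only
    increase it, as [l >= 0]. This makes all later denominators nonzero. *)
Lemma weight_gt0 j : (j < nu)%N -> 0 < D%:R - j%:R * l.
Proof.
move=> jnu; have [M iM Mnu] := nu_ex.
have nu0 : 0 < nu%:R :> rat by rewrite ltr0n; apply: leq_ltn_trans jnu.
have : 0 < nu%:R * (D%:R - (nu%:R - 1) * l) :> rat.
  rewrite -Mnu -card_dominated // ltr0n.
  apply: leq_trans (subset_leq_card (sub_dominated iM)).
  by rewrite Mnu; apply: leq_ltn_trans jnu.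
rewrite pmulr_rgt0 // => /lt_le_trans; apply.
rewrite lerD2l lerN2; apply: ler_wpM2r; first by rewrite /l divr_ge0 ?ler0n.
by rewrite lerBrDr natr1 ler_nat.
Qed.

(** * Orderings in which a given independent set consists of local minima *)

(* Remove the first element [x] of an ordering of [S]: if [x] is not dominated
   by [M] the condition on [M] is unchanged, if [x \in M] it becomes the
   condition on [M :\ x], and otherwise it fails. *)
Lemma count_sub_local_minima_rec (S M : {set T}) :
  independent M -> S \subset E -> M \subset S -> S != set0 ->
  count (fun s => M \subset local_minima s) (permutations (enum S)) =
  (\sum_(x in S :\: dominated M)
      count (fun s => M \subset local_minima s) (permutations (enum (S :\ x))) +
   \sum_(x in M)
      count (fun s => M :\ x \subset local_minima s)
        (permutations (enum (S :\ x))))%N.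
Proof.
move=> iM SE MS S0; have /independentP[ME Mr] := iM.
(* The first entry [x] is itself a local minimum, so only [M :\ x] is constrained: none of it may
   conflict with [x]. *)
have step x s : x \in S -> s \in permutations (enum (S :\ x)) ->
    (M \subset local_minima (x :: s)) =
    [forall y in M :\ x, ~~ r y x] && (M :\ x \subset local_minima s).
  move=> xS; rewrite mem_permutations => /perm_mem sS.
  rewrite local_minima_cons; last by rewrite sS mem_enum !inE eqxx.
  apply/subsetP/andP => [h|[/forall_inP h1 /subsetP h2] y yM].
    split; [apply/forall_inP => y | apply/subsetP => y];
      by rewrite !inE => /andP[/negPf yx /h]; rewrite !inE yx => /andP[].
  case: (eqVneq y x) => [->|yx]; first by rewrite setU11.
  have yMx : y \in M :\ x by rewrite !inE yx.
  by rewrite in_setU1 (negPf yx) inE h1 ?h2.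
rewrite count_permutations_enum // (bigID [in dominated M]) /= addnC.
congr (_ + _)%N.
  apply: eq_big => [x|x /andP[xS xM]]; first by rewrite !inE andbC.
  have nxM : x \notin M by apply: contra xM; apply/subsetP/sub_dominated.
  apply: eq_in_count => s /(step _ _ xS) ->.
  have -> : M :\ x = M by apply/setDidPl; rewrite disjoint_sym disjoints1.
  case: forall_inP => // -[] y yM; apply: contra xM => ryx.
  by apply/dominatedP; split; [apply: (subsetP SE) | exists y].
rewrite (bigID [in M]) /= [X in (_ + X)%N]big1 ?addn0.
  apply: eq_big => [x|x /andP[/andP[xS _] xM]].
    rewrite andbC; case: (boolP (x \in M)) => //= xM.
    by rewrite (subsetP MS) // (subsetP (sub_dominated iM)).
  apply: eq_in_count => s /(step _ _ xS) ->.
  case: forall_inP => // -[] y; rewrite !inE => /andP[yx yM].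
  by apply: contra yx => /(Mr _ _ yM xM) ->.
move=> x /andP[/andP[xS /dominatedP[_ [y yM ryx]]] xM].
rewrite (eq_in_count (a2 := pred0)) ?count_pred0 // => s /(step _ _ xS) ->.
have yx : y != x by apply: contraNneq xM => <-.
by apply/negP => /andP[/forall_inP/(_ y)]; rewrite !inE yx yM ryx => /(_ isT).
Qed.

(** Induction on [|S|], whence the general [S]. With [m = |M|], [n = |S| - 1] and [w] the product in
    the denominator, the recursion reads [(|S| - |dominated M|) n! / w m + m n! / w (m - 1)]. Since
    [|dominated M| = m w m / w (m - 1)], the last term cancels the subtracted one and [|S| n! / w m]
    remains. *)
Lemma count_sub_local_minima (S M : {set T}) :
  independent M -> dominated M \subset S -> S \subset E ->
  (count (fun s => M \subset local_minima s) (permutations (enum S)))%:R =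
  (#|S|`!)%:R / \prod_(j < #|M|) (D%:R - j%:R * l) :> rat.
Proof.
move: {2}#|S| (erefl #|S|) => n; elim: n S M => [|n IHn] S M Sn iM MS SE.
  have S0 : S = set0 by apply/eqP; rewrite -cards_eq0 Sn.
  have M0 : M = set0.
    apply/eqP; rewrite -subset0 -S0; apply: subset_trans MS.
    exact: sub_dominated.
  rewrite S0 M0 enum_set0 cards0 big_ord0 divr1 (eq_count (a2 := predT)).
    by rewrite count_predT size_permutations.
  by move=> s; rewrite sub0set.
have MS' := subset_trans (sub_dominated iM) MS.
have S0 : S != set0 by rewrite -card_gt0 Sn.
have SxE x : S :\ x \subset E by apply: subset_trans (subsetDl _ _) SE.
have cardSx x : x \in S -> #|S :\ x| = n.
  by move=> xS; move: Sn; rewrite (cardsD1 x) xS => -[].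
have Mnu := nu_max iM.
rewrite count_sub_local_minima_rec // natrD !natr_sum.
pose w k : rat := \prod_(j < k) (D%:R - j%:R * l).
rewrite -/(w #|M|).
rewrite (eq_bigr (fun=> (n`!)%:R / w #|M|)); last first.
  move=> x; rewrite inE => /andP[xM xS]; rewrite IHn ?cardSx //.
  by rewrite subsetD1 MS xM.
rewrite sumr_const cardsD (setIidPr MS) -[_ *+ (_ - _)]mulr_natl natrB ?subset_leq_card //.
rewrite (eq_bigr (fun=> (n`!)%:R / w #|M|.-1)); last first.
  move=> x xM; have xS := subsetP MS' _ xM.
  have cM : #|M :\ x| = #|M|.-1 by rewrite [in RHS](cardsD1 x) xM.
  rewrite IHn ?cardSx ?cM //; first exact: independentS (subsetDl _ _) iM.
  (* By independence [x] is not dominated by [M :\ x], so removing [x] from [S] keeps that dominated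
     set inside. *)
  rewrite subsetD1 (subset_trans (dominatedS (subsetDl _ _)) MS) /=.
  apply/negP => /dominatedP[_ [y]]; rewrite !inE => /andP[yx yM] ryx.
  by have /independentP[_ /(_ y x yM xM ryx) yxE] := iM; rewrite yxE eqxx in yx.
rewrite sumr_const card_dominated // -[_ *+ #|M|]mulr_natl Sn factS natrM.
case: (posnP #|M|) => [->|M0]; first by rewrite /w !big_ord0; field.
rewrite -(prednK M0) in Mnu *; set m := #|M|.-1 in Mnu *.
rewrite /w big_ord_recr /= -/(w m).
have m0 : D%:R - m%:R * l != 0 by rewrite gt_eqF // weight_gt0.
have w0 : w m != 0.
  apply/prodf_neq0 => j _; rewrite gt_eqF // weight_gt0 //.
  exact: ltn_trans (ltn_ord j) Mnu.
by rewrite -[m.+1%:R]natr1; field; rewrite m0 w0.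
Qed.

(** * Counting independent sets by size *)

(** Double counting of pairs [(M, x)] with [x] in [M] and [|M| = k + 1]: equivalently, [x] is an
    undominated element added to an independent [k]-set. *)
Lemma card_independent_rec k :
  k.+1%:R * #|[set M | independent M & #|M| == k.+1]|%:R =
  #|[set M | independent M & #|M| == k]|%:R *
    (#|E|%:R - k%:R * (D%:R - (k%:R - 1) * l)) :> rat.
Proof.
transitivity (\sum_(M in [set M | independent M & #|M| == k.+1]) \sum_(x in M) 1 : rat).
  rewrite (eq_bigr (fun=> k.+1%:R)).
    by rewrite sumr_const mulr_natr.
  by move=> M; rewrite inE => /andP[_ /eqP Mk]; rewrite sumr_const Mk.
transitivity (\sum_(M in [set M | independent M & #|M| == k])
    \sum_(x in E :\: dominated M) 1 : rat); last first.
  rewrite (eq_bigr (fun=> #|E|%:R - k%:R * (D%:R - (k%:R - 1) * l))).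
    by rewrite sumr_const [RHS]mulr_natl.
  move=> M; rewrite inE => /andP[iM /eqP Mk]; rewrite sumr_const -Mk -card_dominated //.
  have dE : dominated M \subset E by apply/subsetP => x /dominatedP[].
  by rewrite cardsD (setIidPr dE) natrB ?subset_leq_card.
rewrite (exchange_big_dep predT) //= [RHS](exchange_big_dep predT) //=.
apply: eq_bigr => x _.
(* For fixed [x], adding and deleting [x] are inverse to each other. *)
rewrite (reindex_onto (fun M => x |: M) (fun M => M :\ x)); last first.
  by move=> M /andP[_ xM]; rewrite setD1K.
apply: eq_bigl => M.
rewrite [_ |: _ \in [set _ | _ & _]]inE [M \in [set _ | _ & _]]inE setU11 andbT.
have -> : ((x |: M) :\ x == M) = (x \notin M).
  apply/eqP/idP => [<-|xM]; first by rewrite !inE eqxx.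
  by rewrite setU1K.
rewrite andbAC independentU1; case: (boolP (independent M)) => //= iM.
rewrite [RHS]andbC; case: (boolP (x \in E :\: _)) => //=; rewrite inE => /andP[xM _].
have xnM : x \notin M by apply: contra xM; apply/subsetP/sub_dominated.
by rewrite cardsU1 xnM add1n eqSS.
Qed.

(** By [card_setE] the number of extensions of a [k]-set factors as [(nu - k) (D - (nu - 1 + k) l)],
    and [(nu - k) 'C(nu, k) = (k + 1) 'C(nu, k + 1)]. *)
Lemma card_independent k :
  #|[set M | independent M & #|M| == k]|%:R =
  'C(nu, k)%:R * \prod_(j < k) (D%:R - (nu%:R - 1 + j%:R) * l) :> rat.
Proof.
elim: k => [|k IHk].
  rewrite bin0 big_ord0 mulr1 (_ : [set _ | _ & _] = [set set0]) ?cards1 //.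
  apply/setP => M; rewrite !inE cards_eq0 andbC; case: eqP => //= ->.
  apply/independentP; split; first exact: sub0set.
  by move=> x y; rewrite inE.
apply: (mulfI (_ : k.+1%:R != 0)); first by rewrite pnatr_eq0.
rewrite card_independent_rec IHk card_setE big_ord_recr /= [RHS]mulrA -natrM.
have -> : (k.+1 * 'C(nu, k.+1))%:R = (nu%:R - k%:R) * 'C(nu, k)%:R :> rat.
  have [knu|nuk] := leqP k nu; first by rewrite mul_bin_left natrM natrB.
  by rewrite !bin_small ?muln0 ?mulr0 // ltnW.
by field.
Qed.

(** * Evaluation of the alternating sum *)

Lemma one_local_minimum_fraction : (0 < nu)%N ->
  (count (fun s => #|local_minima s| == 1)%N (permutations (enum E)))%:R /
    (#|E|`!)%:R =
  (nu`!)%:R * l ^+ nu.-1 / \prod_(j < nu.-1) (D%:R - j%:R * l) :> rat.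
Proof.
move=> nu0; rewrite count_one_local_minimum.
pose w k : rat := \prod_(j < k) (D%:R - j%:R * l).
have w_neq0 k : (k <= nu)%N -> w k != 0.
  move=> knu; apply/prodf_neq0 => j _; rewrite gt_eqF // weight_gt0 //.
  exact: leq_trans (ltn_ord j) knu.
pose F k : rat := (#|E|`!)%:R / w k * ((-1) ^+ k * k%:R).
rewrite (eq_bigr (fun M : {set T} => F #|M|)); last first.
  move=> M iM; rewrite count_sub_local_minima //.
  by apply/subsetP => x /dominatedP[].
(* Group the independent sets by size; [inord] is faithful because sizes are at most [nu]. *)
rewrite (partition_big (fun M : {set T} => inord #|M| : 'I_nu.+1) predT) //=.
rewrite (eq_bigr (fun k : 'I_nu.+1 =>
  #|[set M | independent M & #|M| == k]|%:R * F k)); last first.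
  move=> k _; rewrite mulr_natl -sumr_const.
  apply: eq_big => [M|M /andP[iM]].
    rewrite inE; case: (boolP (independent M)) => //= iM.
    by rewrite -val_eqE /= inordK // ltnS nu_max.
  by rewrite -val_eqE /= inordK ?ltnS ?nu_max // => /eqP ->.
have E0 : (#|E|`!)%:R != 0 :> rat by rewrite pnatr_eq0 -lt0n fact_gt0.
have F0 : F 0%N = 0 by rewrite /F !mulr0.
rewrite big_ord_recl F0 mulr0 add0r.
move: w_neq0 card_independent nu0; case: (nu) => // n w_neq0 cardI _.
(* The [k = 0] term vanishes. Shifting [k] by one and splitting off the first factors [D - n l] and
   [D] leaves products starting at [b] and [c]. *)
pose c : rat := D%:R - l; pose b : rat := D%:R - n.+1%:R * l.
have shift k : w k.+1 = D%:R * \prod_(j < k) (c - j%:R * l).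
  rewrite /w big_ord_recl mul0r subr0; congr (_ * _); apply: eq_bigr => j _.
  by rewrite lift0 -natr1 /c; ring.
have shiftb k : \prod_(j < k.+1) (D%:R - (n.+1%:R - 1 + j%:R) * l) =
   (D%:R - n%:R * l) * \prod_(j < k) (b - j%:R * l).
  rewrite big_ord_recl -natr1 addr0 addrK; congr (_ * _); apply: eq_bigr => j _.
  by rewrite lift0 /b -[n.+1%:R]natr1 -natr1; ring.
have D0 : D%:R != 0 :> rat.
  by move: (w_neq0 1%N isT); rewrite /w big_ord1 mul0r subr0.
have c_neq0 j : (j < n)%N -> c - j%:R * l != 0.
  move=> jn; have := w_neq0 j.+2 jn; rewrite shift mulf_eq0 negb_or => /andP[_].
  by rewrite big_ord_recr mulf_eq0 negb_or => /andP[].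
have V := chu_vandermonde b c_neq0.
transitivity (n.+1%:R * (D%:R - n%:R * l) / D%:R *
    (\prod_(j < n) (c - b - j%:R * l) / \prod_(j < n) (c - j%:R * l))).
  rewrite -V mulr_sumr -sumrN mulr_suml; apply: eq_bigr => k _.
  have binE : n.+1%:R * 'C(n, k)%:R = k.+1%:R * 'C(n.+1, k.+1)%:R :> rat.
    by rewrite -!natrM -mul_bin_diag.
  have c0 : \prod_(j < k) (c - j%:R * l) != 0.
    apply/prodf_neq0 => j _; apply: c_neq0.
    exact: leq_trans (ltn_ord j) (ltn_ord k).
  rewrite lift0 cardI /F shiftb shift exprS.
  rewrite [RHS](_ : _ = (k.+1%:R * 'C(n.+1, k.+1)%:R) * (-1) ^+ k *
    (D%:R - n%:R * l) / D%:R * (\prod_(j < k) (b - j%:R * l) /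
     \prod_(j < k) (c - j%:R * l))); last by rewrite -binE; ring.
  by field; rewrite E0 D0 c0.
(* Here [c - b = n l], so the factors are [(n - j) l]. *)
have -> : \prod_(j < n) (c - b - j%:R * l) = (n`!)%:R * l ^+ n.
  rewrite -ffactnn ffact_prod natr_prod -[n in l ^+ n]card_ord -prodr_const.
  rewrite -big_split; apply: eq_bigr => j _ /=.
  by rewrite natrB 1?ltnW // /c /b -natr1; ring.
have c0 : \prod_(j < n) (c - j%:R * l) != 0.
  by apply/prodf_neq0 => j _; apply: c_neq0.
(* Both sides are [w n.+1], with the first or the last factor split off; this cancels the prefactor
   [(D - n l) / D]. *)
have wE : D%:R * \prod_(j < n) (c - j%:R * l) = w n * (D%:R - n%:R * l).
  by rewrite -shift /w big_ord_recr.
have := w_neq0 n.+1 (leqnn _); rewrite shift wE mulf_eq0 negb_or => /andP[wn0 m0].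
rewrite -/(w n) factS natrM mulrACA -invfM wE.
by field; rewrite wn0 m0.
Qed.

End LocalMinima.

(** * Shellings as orderings with a single local minimum *)

Section Shellings.
Variable V : finType.
Implicit Types (A B C : {set V}) (F : {set {set V}}) (s : seq {set V}).

Definition is_pair A : Prop := exists x y, A = [set x; y].

(* [share_vertex] alone is not reflexive: the empty set does not meet itself. *)
Definition conflict A B : bool := (A == B) || share_vertex A B.

Lemma conflict_refl : reflexive conflict.
Proof. by move=> A; rewrite /conflict eqxx. Qed.

Lemma share_vertex_sym : symmetric (@share_vertex V).
Proof. by move=> A B; rewrite /share_vertex setIC. Qed.

Lemma conflict_sym : symmetric conflict.
Proof. by move=> A B; rewrite /conflict eq_sym share_vertex_sym. Qed.

Lemma share_vertexP A B :
  reflect (exists2 x, x \in A & x \in B) (share_vertex A B).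
Proof.
rewrite /share_vertex; apply: (iffP (set0Pn _)) => -[x].
  by rewrite inE => /andP[]; exists x.
by move=> xA xB; exists x; rewrite inE xA.
Qed.

Lemma conflict_pair A B : is_pair A -> conflict A B = share_vertex A B.
Proof.
move=> [x [y ->]]; rewrite /conflict; case: eqP => //= <-.
by apply/esym/share_vertexP; exists x; rewrite set21.
Qed.

Let pair_rel F : rel V := fun u v => [set u; v] \in F.

Lemma connect_pair_sym F : connect_sym (pair_rel F).
Proof. by apply: sym_connect_sym => u v; rewrite /pair_rel setUC. Qed.

Lemma connect_in_pair F A x y :
  is_pair A -> A \in F -> x \in A -> y \in A -> connect (pair_rel F) x y.
Proof.
move=> [u [v ->]] AF; rewrite !inE.
have uv : connect (pair_rel F) u v by apply: connect1.
by move=> /orP[]/eqP-> /orP[]/eqP-> //; rewrite connect_pair_sym.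
Qed.

Lemma induces_connected1 A : is_pair A -> induces_connected [set A].
Proof.
move=> pA; have cE : cover [set A] = A by rewrite /cover big_set1.
apply/forall_inP => x; rewrite cE => xA; apply/forall_inP => y yA.
by apply: (connect_in_pair pA) => //; rewrite inE.
Qed.

(** If [A] met no edge of [F], its vertex set would be closed under adjacency and cut off from [F].
    Conversely, every vertex reaches a common vertex [z] of [A] and some edge of [F]. *)
Lemma induces_connectedU1 F A :
  F != set0 -> {in A |: F, forall B, is_pair B} -> induces_connected F ->
  induces_connected (A |: F) = [exists B in F, share_vertex A B].
Proof.
move=> /set0Pn[B0 B0F] pF cF; apply/idP/exists_inP => [cAF|[B BF]].
  case: (pickP [pred B in F | share_vertex A B]) => [B /andP[]|nAF].
    by exists B.
  have {}nAF B x : B \in F -> x \in B -> x \notin A.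
    move=> BF xB; apply/negP => xA; have := nAF B; rewrite inE BF /=.
    by move/share_vertexP; apply; exists x.
  have clA : closed (pair_rel (A |: F)) A.
    move=> u v; rewrite /pair_rel !inE => /orP[/eqP <-|uvF].
      by rewrite !inE !eqxx orbT.
    by rewrite !(negPf (nAF _ _ uvF _)) ?inE ?eqxx ?orbT.
  have [x [x2 AE]] := pF A (setU11 _ _).
  have [y [y2 B0E]] := pF B0 (setU1r _ B0F).
  have xA : x \in A by rewrite AE set21.
  have yB0 : y \in B0 by rewrite B0E set21.
  have := forall_inP cAF x (subsetP (bigcup_sup A (setU11 _ _)) x xA).
  move/forall_inP/(_ y (subsetP (bigcup_sup B0 (setU1r _ B0F)) y yB0)).
  move/(closed_connect clA); rewrite xA => /esym yA.
  by have := nAF _ _ B0F yB0; rewrite yA.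
move=> /share_vertexP[z zA zB].
have toz x : x \in cover (A |: F) -> connect (pair_rel (A |: F)) x z.
  move=> /bigcupP[C]; rewrite in_setU1 => /predU1P[->|CF] xC.
    by apply: (connect_in_pair (pF A (setU11 _ _))); rewrite ?setU11.
  have xF : x \in cover F by apply/bigcupP; exists C.
  have zF : z \in cover F by apply/bigcupP; exists B.
  move: (forall_inP (forall_inP cF x xF) z zF); apply: connect_sub => u v uv.
  by apply: connect1; rewrite /pair_rel setU1r.
apply/forall_inP => x /toz xz; apply/forall_inP => y /toz yz.
by apply: connect_trans xz _; rewrite connect_pair_sym.
Qed.

(** The connectivity clause of [is_shelling] for sequences of any length, so that induction on the
    last entry is possible. *)
Definition connected_prefixes s : bool :=
  all (fun i => induces_connected [set A in take i.+1 s]) (iota 0 (size s)).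

Lemma connected_prefixes_rcons s A :
  connected_prefixes (rcons s A) =
  connected_prefixes s && induces_connected [set B in rcons s A].
Proof.
rewrite /connected_prefixes size_rcons -addn1 iotaD all_cat /= andbT add0n.
rewrite -[in X in take X](size_rcons s A) take_size; congr (_ && _).
apply: eq_in_all => i; rewrite mem_iota add0n => /= si.
by rewrite -cats1 takel_cat.
Qed.

Lemma connected_prefixes_full s :
  s != [::] -> connected_prefixes s -> induces_connected [set A in s].
Proof.
case/lastP: s => // s A _.
by rewrite connected_prefixes_rcons => /andP[].
Qed.

(** An appended edge breaks connectivity exactly when it meets no earlier edge, that is, when it is
    a new local minimum. *)
Lemma connected_prefixesE s :
  s != [::] -> uniq s -> {in s, forall A, is_pair A} ->
  connected_prefixes s = (#|local_minima conflict s| == 1)%N.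
Proof.
move=> s0 us ps.
(* Positivity joins the induction: it ensures that a new minimum brings the count to at least two,
   and that a count other than one never returns to one. *)
suff [] : connected_prefixes s = (#|local_minima conflict s| == 1)%N /\
   (0 < #|local_minima conflict s|)%N by [].
elim/last_ind: s s0 us ps => // s A IHs _; rewrite rcons_uniq => /andP[As us] ps.
rewrite connected_prefixes_rcons local_minima_rcons //.
case: (eqVneq s [::]) As us ps IHs => [-> _ _ ps _|s0 As us ps IHs].
  have -> : A |: local_minima conflict [::] = [set A].
    by apply/setP => B; rewrite !inE orbF.
  rewrite /= cards1 eqxx; split=> //.
  rewrite (_ : [set _ in _] = [set A]); last by apply/setP => B; rewrite !inE.
  by apply: induces_connected1; apply: ps; rewrite inE.
have pA : is_pair A by apply: ps; rewrite mem_rcons mem_head.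
have [] // := IHs isT us; first by move=> B Bs; apply: ps; rewrite mem_rcons inE Bs orbT.
move=> sE s_gt0.
have Alm : A \notin local_minima conflict s by rewrite inE (negPf As).
have rE : [set B in rcons s A] = A |: [set B in s].
  by apply/setP => B; rewrite !inE mem_rcons inE.
split; last by case: ifP; rewrite ?cardsU1 ?Alm.
case: (boolP (connected_prefixes s)) sE => [cs|_] /esym sE /=; last first.
  case: ifP; rewrite ?sE // cardsU1 Alm add1n eqSS => _.
  by rewrite eqn0Ngt s_gt0.
rewrite rE induces_connectedU1 ?connected_prefixes_full //.
- have -> : [exists B in [set B in s], share_vertex A B] = has (conflict A) s.
    apply/exists_inP/hasP => -[B]; rewrite ?inE => Bs.
      by rewrite -conflict_pair //; exists B.
    by rewrite conflict_pair //; exists B; rewrite ?inE.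
  case: ifP; rewrite ?sE // cardsU1 Alm add1n eqSS => _.
  by rewrite eqn0Ngt s_gt0.
- case: s s0 {IHs As us ps cs sE s_gt0 Alm rE} => // B s _.
  by apply/set0Pn; exists B; rewrite !inE eqxx.
- by move=> B; rewrite -rE inE => /ps.
Qed.

End Shellings.

(** * From the graph hypotheses to the abstract conflict relation *)

Section Graph.
Variables (V : finType) (g : rel V).
Implicit Types (A B C : {set V}) (M : {set {set V}}).

Local Notation E := (edges g).

Lemma edges_pair A : A \in E -> is_pair A.
Proof. by move=> /imsetP[[x y] _ ->]; exists x, y. Qed.

Lemma is_matchingE M : is_matching g M = independent E (@conflict V) M.
Proof.
rewrite /is_matching /independent; congr (_ && _).
apply: eq_forallb => A; congr (_ ==> _); apply: eq_forallb => B.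
congr (_ ==> _); rewrite /edge_indep /conflict.
by case: eqP => //=; case: share_vertex.
Qed.

(** Without edges, the empty ordering is a shelling with no local minimum; hence [E != set0]. *)
Lemma num_shellingsE : E != set0 ->
  num_shellings g =
  count (fun s => #|local_minima (@conflict V) s| == 1)%N (permutations (enum E)).
Proof.
move=> E0.
rewrite /num_shellings cardE -(size_map val) -size_filter.
apply/perm_size/uniq_perm.
- by rewrite map_inj_uniq ?enum_uniq //; apply: val_inj.
- by rewrite filter_uniq ?permutations_uniq.
have permE s : perm_eq s (enum E) = uniq s && ([set A in s] == E).
  apply/idP/andP => [sE|[us /eqP sE]].
    split; first by rewrite (perm_uniq sE) enum_uniq.
    by apply/eqP/setP => A; rewrite inE (perm_mem sE) mem_enum.
  apply: uniq_perm => //; first exact: enum_uniq.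
  by move=> A; rewrite mem_enum -sE inE.
have shE (t : #|E|.-tuple {set V}) : is_shelling t =
    perm_eq t (enum E) && (#|local_minima (@conflict V) t| == 1)%N.
  rewrite permE /is_shelling -andbA; case: (boolP (uniq t)) => //= ut.
  case: eqP => //= tE; rewrite -connected_prefixesE //.
  - apply/forallP/allP => [h i|h i].
      by rewrite mem_iota size_tuple => /= iE; apply: (h (Ordinal iE)).
    by apply: h; rewrite mem_iota size_tuple /=.
  - apply: contraNneq E0 => t0; rewrite -subset0 -tE; apply/subsetP => A.
    by rewrite inE memtE t0.
  - by move=> A At; apply: edges_pair; rewrite -tE inE.
move=> s; rewrite mem_filter mem_permutations andbC; apply/mapP/idP => [[t]|].
  by rewrite mem_enum inE shE => ? ->.
move=> /[dup] /andP[/perm_size]; rewrite -cardE => /eqP sz _ h.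
by exists (Tuple sz) => //; rewrite mem_enum inE shE.
Qed.

Lemma conflict_degree d :
  (forall A, A \in E -> #|[set B in E | edge_adj A B]| = d) ->
  forall A, A \in E -> #|[set B in E | conflict A B]| = d.+1.
Proof.
move=> degE A AE; rewrite -(degE A AE).
rewrite (_ : [set B in E | conflict A B] = A |: [set B in E | edge_adj A B]).
  by rewrite cardsU1 !inE /edge_adj eqxx /= andbF.
apply/setP => B; rewrite !inE /edge_adj /conflict [B == A]eq_sym.
by case: eqP => [<-|]; rewrite ?AE.
Qed.

Lemma conflict_connecting lambda :
  (forall A B, A \in E -> B \in E -> edge_indep A B ->
     #|[set C in E | edge_connects C A B]| = lambda) ->
  forall A B, A \in E -> B \in E -> ~~ conflict A B ->
    #|[set C in E | conflict A C && conflict B C]| = lambda.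
Proof.
move=> connE A B AE BE; rewrite negb_or => nAB; rewrite -(connE A B AE BE nAB).
apply: eq_card => C; rewrite !inE /edge_connects !(share_vertex_sym C).
by rewrite !conflict_pair //; apply: edges_pair.
Qed.

(** Send each member of [M] meeting [A] to an endpoint of [A] that it contains; disjointness within
    [M] makes this injective. *)
Lemma conflict_matching_le2 M A :
  independent E (@conflict V) M -> A \in E ->
  (#|[set B in M | conflict B A]| <= 2)%N.
Proof.
move=> /independentP[/subsetP ME Mr] AE; have [a [b AE2]] := edges_pair AE.
pose f B := if a \in B then a else b.
have fP B : B \in [set B in M | conflict B A] -> f B \in B.
  rewrite inE => /andP[BM]; rewrite conflict_pair; last exact/edges_pair/ME.
  move/share_vertexP=> [x xB]; rewrite AE2 !inE /f; case: ifP => // aB.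
  by move=> /orP[]/eqP xE; rewrite -xE ?xB // -xE xB in aB *.
rewrite -(card_in_imset (f := f)).
  apply: (@leq_trans #|[set a; b]|); last by rewrite cards2; case: eqP.
  apply/subset_leq_card/subsetP => x /imsetP[B _ ->].
  by rewrite !inE /f; case: ifP; rewrite eqxx ?orbT.
move=> B C BS CS fBC; have fB := fP B BS; have := fP C CS; rewrite -fBC => fC.
move: BS CS; rewrite !inE => /andP[BM _] /andP[CM _].
by apply: Mr => //; apply/orP; right; apply/share_vertexP; exists (f B).
Qed.

Lemma max_matching :
  exists2 M, independent E (@conflict V) M & #|M| = matching_number g.
Proof.
have : (0 < #|is_matching g|)%N.
  apply/card_gt0P; exists set0; rewrite -[_ \in _]/(is_matching g set0) is_matchingE.
  by apply/independentP; split=> [|A B]; rewrite ?sub0set ?inE.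
move=> /(eq_bigmax_cond (fun M : {set {set V}} => #|M|))[M MM ME].
by exists M; rewrite -?is_matchingE.
Qed.

End Graph.

(** * The closed formula *)

(** For [l != 0], clear [l ^+ n]. For [l = 0], [D / l] is [0] by convention; if [n > 0] then
    [gbinom 0 n = 0], so the left side is [0], matching [l ^+ n = 0] on the right. *)
Lemma gbinom_scaled (n : nat) (D l : rat) :
  (n.+1)%:R / gbinom (D / l) n =
  (n.+1)`!%:R * l ^+ n / \prod_(j < n) (D - j%:R * l).
Proof.
have [->|l0] := eqVneq l 0.
  case: n => [|n]; first by rewrite /gbinom !big_ord0; field.
  rewrite /gbinom invr0 mulr0 big_ord_recl subrr mul0r mul0r invr0 mulr0.
  by rewrite exprS mul0r mulr0 mul0r.
have -> : \prod_(j < n) (D - j%:R * l) = l ^+ n * \prod_(j < n) (D / l - j%:R).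
  rewrite -[n in l ^+ n]card_ord -prodr_const -big_split; apply: eq_bigr => j _ /=.
  by field.
rewrite /gbinom factS natrM !invfM invrK; move: (\prod_(j < n) _)^-1 => x.
by field; rewrite expf_neq0.
Qed.

Theorem theorem6 (V : finType) (g : rel V)
  (g_sym : symmetric g) (g_irr : irreflexive g)
  (nu d lambda : nat)
  (nuE : matching_number g = nu) (nu_gt0 : (0 < nu)%N)
  (degE : forall A : {set V}, A \in edges g ->
     #|[set B in edges g | edge_adj A B]| = d)
  (connE : forall A B : {set V}, A \in edges g -> B \in edges g ->
     edge_indep A B -> #|[set C in edges g | edge_connects C A B]| = lambda) :
  (num_shellings g)%:R / (#|edges g|`!)%:R =
    nu%:R / gbinom ((d%:R + 1) / (lambda%:R / 2%:R)) (nu - 1) :> rat.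
Proof.
have [M iM Mnu] := max_matching g; rewrite nuE in Mnu.
have E0 : edges g != set0.
  have /independentP[ME _] := iM; rewrite -card_gt0.
  by apply: leq_trans (subset_leq_card ME); rewrite Mnu.
have nu_max (M' : {set {set V}}) :
    independent (edges g) (@conflict V) M' -> (#|M'| <= nu)%N.
  by rewrite -is_matchingE -nuE; apply: leq_bigmax_cond.
rewrite num_shellingsE // (one_local_minimum_fraction (@conflict_refl V)
  (@conflict_sym V) (conflict_degree degE) (conflict_connecting connE)
  (@conflict_matching_le2 V g) nu_max (ex_intro2 _ _ M iM Mnu) nu_gt0).
by case: nu nu_gt0 {nuE Mnu nu_max} => // n _; rewrite subn1 natr1 gbinom_scaled.
Qed.
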